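(* Let $k \ge 1$ be an integer and let $p$ be a $\frac{1}{k-1}$-concave distribution on $\mathbb{R}$ (for $k=1$, $\frac{1}{k-1}$ means $+\infty$). Then $$\left|\mu_3^3(p)\right| \le 2\sqrt{\frac{k+2}{k}}\,\frac{k-1}{k+3}\,\mu_2^3(p).$$ Suppose furthermore that $0\in\mathrm{Supp}(p)$. Then $$\mu_1^2(p) \le k(k+2)\,\mu_2^2(p).$$
   Context: Distributions on $\mathbb{R}$ are absolutely continuous probability distributions, identified with their densities $p:\mathbb{R}\to[0,\infty)$, $\int_{\mathbb{R}} p = 1$. $\mathrm{Supp}(p) = \mathrm{cl}(\{t\in\mathbb{R}: p(t)>0\})$. Moments: $\mu_1(p)=\int_{-\infty}^\infty t\,p(t)\,dt$ is the mean; $\mu_2^2(p)=\int_{-\infty}^\infty (t-\mu_1(p))^2p(t)\,dt$ is the variance, with $\mu_2(p)\ge 0$ its non-negative square root; $\mu_3^3(p)=\int_{-\infty}^\infty (t-\mu_1(p))^3p(t)\,dt$ is the third central moment. $\mu_1^2(p)$ means $(\mu_1(p))^2$ and $\mu_2^3(p)$ means $(\mu_2(p))^3$. For $0<s<\infty$, a distribution $p$ on $\mathbb{R}$ is $s$-concave if for all $\lambda\in[0,1]$ and all $t_1,t_2\in\mathbb{R}$ with $p(t_1)p(t_2)>0$, $$p(\lambda t_1+(1-\lambda)t_2) \ge \left(\lambda\, p(t_1)^s+(1-\lambda)\,p(t_2)^s\right)^{1/s}.$$ For $s=+\infty$ the right-hand side is replaced by $\max\{p(t_1),p(t_2)\}$.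 *)

(* Defs.v *)
From mathcomp Require Import all_boot all_order all_algebra.
From mathcomp Require Import all_classical all_reals all_analysis.

Set Implicit Arguments.
Unset Strict Implicit.
Unset Printing Implicit Defensive.

Import Order.TTheory GRing.Theory Num.Theory.
Import numFieldNormedType.Exports.

Local Open Scope classical_set_scope.
Local Open Scope ring_scope.

(* An absolutely continuous probability distribution on R, identified with
   (a chosen version of) its density. *)
Definition prob_density {R : realType} (p : R -> R) : Prop :=
  [/\ measurable_fun setT p,
      forall t, 0 <= p t &
      (\int[@lebesgue_measure R]_t (p t)%:E)%E = 1%E].

Definition Supp {R : realType} (p : R -> R) : set R :=
  closure [set t | 0 < p t].

(* The moments are real-valued integrals, which default to 0 when the extended
   integral is infinite; this never happens for s-concave distributions with
   s > 0, as these are bounded with bounded support. *)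
Definition mu1 {R : realType} (p : R -> R) : R :=
  \int[@lebesgue_measure R]_t (t * p t).

Definition central_moment {R : realType} (n : nat) (p : R -> R) : R :=
  \int[@lebesgue_measure R]_t ((t - mu1 p) ^+ n * p t).

(* mu2 is the standard deviation; mu3_3 (usually written mu_3 ^ 3) is the third
   central moment itself, and not its cube root. *)
Definition mu2 {R : realType} (p : R -> R) : R :=
  Num.sqrt (central_moment 2 p).
Definition mu3_3 {R : realType} (p : R -> R) : R := central_moment 3 p.

(* s ranges over ]0, +oo]; no function is s-concave for other values of s. *)
Definition s_concave {R : realType} (s : \bar R) (p : R -> R) : Prop :=
  match s with
  | r%:E => 0 < r /\
      forall l t1 t2 : R, 0 <= l <= 1 -> 0 < p t1 * p t2 ->
        (l * (p t1 `^ r) + (1 - l) * (p t2 `^ r)) `^ (1 / r)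
          <= p (l * t1 + (1 - l) * t2)
  | +oo%E =>
      forall l t1 t2 : R, 0 <= l <= 1 -> 0 < p t1 * p t2 ->
        Num.max (p t1) (p t2) <= p (l * t1 + (1 - l) * t2)
  | -oo%E => False
  end.

(* 1 / (k - 1), with the inverse of extended reals, for which 0^-1 = +oo: hence
   the value +oo at k = 1. *)
Definition concavity_exponent {R : realType} (k : nat) : \bar R :=
  (((k%:R - 1)%:E)^-1)%E.

(* Main.v *)
Require Import Defs.
From mathcomp Require Import all_boot all_order all_algebra.
From mathcomp Require Import all_classical all_reals all_analysis.
From mathcomp Require Import measurable_realfun ring lra.
Set Implicit Arguments.
Unset Strict Implicit.
Unset Printing Implicit Defensive.
Import Order.TTheory GRing.Theory Num.Theory.
Import numFieldNormedType.Exports.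
Local Open Scope classical_set_scope.
Local Open Scope ring_scope.

(* Let m = k - 1, so that p^(1/m) is concave on the support of p (for k = 1, p is
   constant there), and let g be the cone density c (t - a)^m on [a, b] with the
   same mean and variance as p; then a = mu1 - d with d^2 = k (k + 2) mu2^2.
   As a concave function meets a line at most twice, p - g changes sign few times.
   If p were positive somewhere left of a, the signs would be +, -, +, and a
   quadratic with the same signs would integrate to 0 against p - g, forcing
   p = g almost everywhere; so the support of p lies right of a.  Hence the signs
   are -, +, -, +, and integrating the corresponding cubic against p - g bounds
   the third central moment of p below by that of g.  Reflecting p gives the
   other bound on the support and on the third moment. *)

(** * Concavity of the m-th root of a density *)

(* States that p dominates C f^m along segments as soon as f >= 0 is affine, f <> 0
   at the point considered, and p >= C f^m at the endpoints where f <> 0.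
   Excluding the zeros of f covers m = 0, where f^0 = 1. *)
Definition power_concave {R : realType} (m : nat) (p : R -> R) : Prop :=
  forall C A B l x y : R, 0 < p x -> 0 < p y -> 0 < C -> 0 <= A -> 0 <= B ->
    0 <= l <= 1 -> (0 < A -> C * A ^+ m <= p x) ->
    (0 < B -> C * B ^+ m <= p y) -> 0 < l * A + (1 - l) * B ->
    C * (l * A + (1 - l) * B) ^+ m <= p (l * x + (1 - l) * y).

(** For [m > 0], the m-th root of C f^m is C^(1/m) f, which is affine, so concavity of p^(1/m)
    passes its endpoint bounds on to the segment. For [m = 0], [A] or [B] is positive, so [C] is at
    most the larger endpoint value. *)
Lemma s_concave_power_concave (R : realType) (m : nat) (p : R -> R) :
  s_concave (concavity_exponent m.+1) p -> power_concave m p.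
Proof.
rewrite /concavity_exponent; case: m => [|m].
  rewrite subrr inve0 /= => sp C A B l x y px py C0 A0 B0 l01 HA HB AB.
  apply: le_trans (sp l x y l01 (mulr_gt0 px py)).
  rewrite expr0 mulr1 le_max.
  have [A1|A1] := ltP 0 A; first by have := HA A1; rewrite expr0 mulr1 => ->.
  have [B1|B1] := ltP 0 B.
    by have := HB B1; rewrite expr0 mulr1 => ->; rewrite orbT.
  (* An absurd case: [A] and [B] both vanish, against [AB]. *)
  have -> : C <= p x by nra.
  by [].
have m0 : (0 : R) < m.+1%:R by rewrite ltr0n.
rewrite -natr1 addrK inver gt_eqF//= => -[r0 sp] C A B l x y px py C0 A0 B0 l01.
move=> HA HB AB.
have rn : (m.+1%:R : R)^-1 != 0 by rewrite gt_eqF.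
have key D q : 0 <= D -> 0 < q -> (0 < D -> C * D ^+ m.+1 <= q) ->
    C `^ m.+1%:R^-1 * D <= q `^ m.+1%:R^-1.
  move=> D0 q0 H; move: D0; rewrite le_eqVlt => /predU1P[<-|D0].
    by rewrite mulr0 powR_ge0.
  have -> : C `^ m.+1%:R^-1 * D = (C * D ^+ m.+1) `^ m.+1%:R^-1.
    rewrite powRM ?exprn_ge0 ?ltW//; congr (_ * _).
    by rewrite -powR_mulrn ?ltW// -powRrM mulfV ?gt_eqF// powRr1 ?ltW.
  apply: ge0_ler_powR; last exact: H.
  - by rewrite invr_ge0.
  - by rewrite nnegrE mulr_ge0 ?exprn_ge0// ltW.
  - by rewrite nnegrE ltW.
apply: le_trans (sp l x y l01 (mulr_gt0 px py)).
rewrite div1r invrK powR_mulrn; last first.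
  by rewrite addr_ge0// mulr_ge0// ?powR_ge0//; case/andP: l01 => *; lra.
have -> : C * (l * A + (1 - l) * B) ^+ m.+1 =
    (C `^ m.+1%:R^-1 * (l * A + (1 - l) * B)) ^+ m.+1.
  rewrite exprMn; congr (_ * _).
  by rewrite -powR_mulrn ?powR_ge0// -powRrM mulVf ?gt_eqF// powRr1 ?ltW.
rewrite lerXn2r ?nnegrE//.
- by rewrite mulr_ge0 ?powR_ge0// ltW.
- by rewrite addr_ge0// mulr_ge0// ?powR_ge0//; case/andP: l01 => *; lra.
- have := key _ _ A0 px HA; have := key _ _ B0 py HB.
  case/andP: l01; nra.
Qed.

Lemma power_concave_reflect (R : realType) (m : nat) (p : R -> R) :
  power_concave m p -> power_concave m (fun t => p (- t)).
Proof.
move=> H C A B l x y px py C0 A0 B0 l01 HA HB AB.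
by rewrite opprD -!mulrN; apply: (H C A B l (- x) (- y)).
Qed.

(** Compare [p] with [p x] times the m-th power of the affine function equal to 1 at [x] and 0 at
    [y]. *)
Lemma power_concave_gt0 (R : realType) (m : nat) (p : R -> R) (x y t : R) :
  power_concave m p -> 0 < p x -> 0 < p y -> x <= t <= y -> 0 < p t.
Proof.
move=> H px py /andP[xt ty].
have [xy|xy] := ltP x y; last by have -> : t = x by lra.
have [ty'|ty'] := ltP t y; last by have -> : t = y by lra.
pose l := (y - t) / (y - x).
have yx : y - x != 0 by lra.
have l0 : 0 < l by rewrite divr_gt0//; lra.
have l1 : l <= 1 by rewrite ler_pdivrMr; lra.
have -> : t = l * x + (1 - l) * y by rewrite /l; field.
apply: lt_le_trans (H (p x) 1 0 l x y _ _ _ _ _ _ _ _ _) => //.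
- by rewrite mulr0 addr0 mulr1 mulr_gt0// exprn_gt0.
- by apply/andP; lra.
- by rewrite expr1n mulr1.
- by rewrite ltxx.
- by lra.
Qed.

Lemma power_concave_half (R : realType) (m : nat) (p : R -> R) (x y l : R) :
  power_concave m p -> 0 < p x -> 0 < p y -> 2^-1 <= l <= 1 ->
  p x / 2 ^+ m <= p (l * x + (1 - l) * y).
Proof.
move=> H px py /andP[l0 l1].
apply: le_trans (H (p x) 1 0 l x y _ _ _ _ _ _ _ _ _) => //.
- rewrite mulr0 addr0 mulr1 ler_wpM2l//; first exact: ltW.
  by rewrite -exprVn lerXn2r// nnegrE; lra.
- by apply/andP; lra.
- by rewrite expr1n mulr1.
- by rewrite ltxx.
- by lra.
Qed.

(** * Null sets and bounds drawn from the total mass *)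

Lemma ae_itv_exists (R : realType) (a b : R) (P : R -> Prop) : a < b ->
  {ae @lebesgue_measure R, forall t, P t} -> exists2 t, a < t < b & P t.
Proof.
move=> ab [N [mN N0 NP]]; apply: contrapT => H.
have : (lebesgue_measure `]a, b[ <= lebesgue_measure N)%E.
  apply: le_measure; rewrite ?inE// => t /=; rewrite in_itv/= => tab.
  by apply: NP => /= Pt; apply: H; exists t.
rewrite N0 lebesgue_measure_itv/= lte_fin ab -EFinB lee_fin; lra.
Qed.

Lemma prob_density_not_ae0 (R : realType) (p : R -> R) : prob_density p ->
  ~ {ae @lebesgue_measure R, forall t, p t = 0}.
Proof.
move=> [mp p0 p1] H.
have : (\int[@lebesgue_measure R]_t (p t)%:E = \int[@lebesgue_measure R]_t 0)%E.
  apply: ae_eq_integral => //; first exact/measurable_EFinP.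
  case: H => N [mN N0 NP]; exists N; split => // t /= nt.
  by apply: NP => /= pt; apply: nt => _; rewrite pt.
by rewrite p1 integral0 => /eqP; rewrite onee_eq0.
Qed.

Lemma prob_density_lower_bound (R : realType) (p : R -> R) (a b C : R) :
  prob_density p -> a <= b -> 0 <= C -> (forall t, a <= t <= b -> C <= p t) ->
  C * (b - a) <= 1.
Proof.
move=> [mp p0 p1] ab C0 H.
rewrite -lee_fin -p1.
have -> : (C * (b - a))%:E = (\int[@lebesgue_measure R]_(t in `[a, b]) C%:E)%E.
  rewrite integral_cst//= lebesgue_measure_itv/= lte_fin.
  by case: ltP => [_|ba]; rewrite ?EFinM//; have -> : b - a = 0 by lra.
apply: (@le_trans _ _ (\int[@lebesgue_measure R]_(t in `[a, b]) (p t)%:E)%E).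
  apply: ge0_le_integral => //.
  by apply/measurable_EFinP; exact: measurable_funTS.
apply: ge0_subset_integral => //.
- exact/measurable_EFinP.
- by move=> t _; rewrite lee_fin.
Qed.

(** * Bounded functions with bounded support, and their integrals *)

(** A single [M] bounds both the values and the support. The class is closed under subtraction, and
    multiplying by a continuous function gives an integrable function. *)
Definition tame {R : realType} (f : R -> R) : Prop :=
  measurable_fun setT f /\
  exists M : R, forall t, `|f t| <= M /\ (M < `|t| -> f t = 0).

(** Since the total mass is 1, a support point cannot have both a large density and a distant
    support point. Fixing one support point bounds the support; fixing two bounds the values. *)
Lemma power_concave_density_tame (R : realType) (m : nat) (p : R -> R) :
  prob_density p -> power_concave m p -> tame p.
Proof.
move=> dp H; have [mp p0 _] := dp; split=> //.
have Q : (0 : R) < 2 ^+ m.+1 by rewrite exprn_gt0.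
(* p >= p x / 2^m on the half of the segment [x, y] that is close to x. *)
have le x y : 0 < p x -> 0 < p y -> p x * `|y - x| <= 2 ^+ m.+1.
  move=> px py.
  have [xy|yx] := leP x y.
    have : p x / 2 ^+ m * ((x + y) / 2 - x) <= 1.
      apply: (prob_density_lower_bound dp); first lra.
        by rewrite divr_ge0 ?exprn_ge0.
      move=> t txy; have [xy'|xy'] := ltP x y; last first.
        have -> : t = 1 * x + (1 - 1) * x by lra.
        by apply: power_concave_half => //; lra.
      have -> : t = (1 - (t - x) / (y - x)) * x + (1 - (1 - (t - x) / (y - x))) * y.
        by field; lra.
      apply: power_concave_half => //.
      have : (t - x) / (y - x) <= 2^-1 by rewrite ler_pdivrMr; lra.
      have : 0 <= (t - x) / (y - x) by rewrite divr_ge0; lra.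
      lra.
    rewrite ger0_norm ?subr_ge0// exprS => h.
    rewrite -[leRHS]mul1r -ler_pdivrMr ?mulr_gt0 ?exprn_gt0//; apply: le_trans h.
    by rewrite le_eqVlt; apply/orP; left; apply/eqP; field; rewrite expf_neq0.
  have : p x / 2 ^+ m * (x - (x + y) / 2) <= 1.
    apply: (prob_density_lower_bound dp); first lra.
      by rewrite divr_ge0 ?exprn_ge0.
    move=> t txy.
    have -> : t = (1 - (x - t) / (x - y)) * x + (1 - (1 - (x - t) / (x - y))) * y.
      by field; lra.
    apply: power_concave_half => //.
    have : (x - t) / (x - y) <= 2^-1 by rewrite ler_pdivrMr; lra.
    have : 0 <= (x - t) / (x - y) by rewrite divr_ge0; lra.
    lra.
  rewrite ltr0_norm ?subr_lt0// exprS => h.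
  rewrite -[leRHS]mul1r -ler_pdivrMr ?mulr_gt0 ?exprn_gt0//; apply: le_trans h.
  by rewrite le_eqVlt; apply/orP; left; apply/eqP; field; rewrite expf_neq0.
have [x px] : exists x, 0 < p x.
  apply: contrapT => h; apply: (prob_density_not_ae0 dp); apply: aeW => t.
  apply/eqP; apply: contrapT => /negP pt; apply: h; exists t.
  by rewrite lt_def pt p0.
(* A density supported on the single point [x] would vanish almost everywhere. *)
have [y yx py] : exists2 y, y != x & 0 < p y.
  apply: contrapT => h; apply: (prob_density_not_ae0 dp).
  exists [set x]; split => //; first by rewrite lebesgue_measure_set1.
  move=> t /= pt; apply/eqP; apply: contrapT => /negP tx; apply: h; exists t => //.
  by rewrite lt_def p0 andbT; exact/eqP.
have yx0 : 0 < `|y - x| by rewrite normr_gt0 subr_eq0.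
(* [M1] bounds [p t]: add the bounds [le] for the pairs (t, x) and (t, y) and use the triangle
   inequality |y - x| <= |t - x| + |t - y|. [M2] bounds [|t|] through the pair (x, t). *)
pose M1 := 2 * 2 ^+ m.+1 / `|y - x|; pose M2 := `|x| + 2 ^+ m.+1 / p x.
have M10 : 0 <= M1 by rewrite divr_ge0// mulr_ge0// ltW.
have M20 : 0 <= M2 by rewrite addr_ge0// divr_ge0// ltW.
exists (M1 + M2) => t.
have [pt|pt] := ltP 0 (p t); last first.
  have -> : p t = 0 by apply/eqP; rewrite eq_le pt p0.
  by rewrite normr0; split=> //; lra.
split.
  rewrite ger0_norm//; apply: (@le_trans _ _ M1); last lra.
  rewrite ler_pdivlMr//.
  have := le _ _ pt px; have := le _ _ pt py.
  have := ler_distD t y x; rewrite (distrC t x).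
  have := p0 t; nra.
have : `|t - x| <= 2 ^+ m.+1 / p x by rewrite ler_pdivlMr// mulrC; exact: le.
have := ler_distD x t 0; rewrite !subr0 /M2 => *; lra.
Qed.

Lemma tame_integrable (R : realType) (h f : R -> R) : continuous h -> tame f ->
  (@lebesgue_measure R).-integrable setT (EFin \o (fun t => h t * f t)).
Proof.
move=> ch [mf [M HM]].
have := @integrable_mkcond _ _ _ (@lebesgue_measure R) `[- M, M] (EFin \o (fun t => h t * f t)) (measurable_itv _).
have -> : (EFin \o (fun t => h t * f t)) \_ `[- M, M] = EFin \o (fun t => h t * f t).
  apply/funext => t; rewrite patchE; case: ifPn => //; rewrite notin_setE/= in_itv/=.
  move=> /negP; rewrite -ler_norml -ltNge => tM.
  by rewrite (HM t).2// mulr0.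
move=> <-.
have -> : EFin \o (fun t => h t * f t) = ((EFin \o h) \* (EFin \o f))%E.
  by apply/funext => t; rewrite /= EFinM.
apply: integrableMl => //.
- apply: continuous_compact_integrable; first exact: segment_compact.
  exact: continuous_subspaceT.
- exact: measurable_funTS.
- exists M; split; first exact: num_real.
  by move=> K MK t _; apply: le_trans (HM t).1 (ltW MK).
Qed.

Lemma tame_sub (R : realType) (f g : R -> R) :
  tame f -> tame g -> tame (fun t => f t - g t).
Proof.
move=> [mf [M HM]] [mg [N HN]]; split; first exact: measurable_funB.
exists (M + N) => t; have [fM f0] := HM t; have [gN g0] := HN t; split.
  by have := ler_normB (f t) (g t); lra.
have := normr_ge0 (f t); have := normr_ge0 (g t) => ? ? ?.
by rewrite f0 ?g0 ?subrr//; lra.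
Qed.

Lemma tame_Rintegral_sub (R : realType) (h f g : R -> R) :
  continuous h -> tame f -> tame g ->
  \int[@lebesgue_measure R]_t (h t * (f t - g t)) =
  \int[@lebesgue_measure R]_t (h t * f t) -
  \int[@lebesgue_measure R]_t (h t * g t).
Proof.
move=> ch tf tg; rewrite -RintegralB//; try exact: tame_integrable.
by apply: eq_Rintegral => t _; rewrite mulrBr.
Qed.

Lemma continuous_shiftX (R : realType) (c : R) (n : nat) :
  continuous (fun t : R => (t - c) ^+ n).
Proof.
move=> t; apply: (@continuous_comp _ _ _ (fun t : R => t - c) (fun t => t ^+ n)).
  by apply: cvgB => //; exact: cvg_cst.
exact: exprn_continuous.
Qed.

(** Reduces the integral of a polynomial against [f] to moments of [f] about any centre [c]. *)
Lemma tame_Rintegral_cubic (R : realType) (f h : R -> R) (c a0 a1 a2 a3 : R) :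
  tame f ->
  (forall t, h t = a0 + a1 * (t - c) + a2 * (t - c) ^+ 2 + a3 * (t - c) ^+ 3) ->
  \int[@lebesgue_measure R]_t (h t * f t) =
  a0 * \int[@lebesgue_measure R]_t f t +
  a1 * \int[@lebesgue_measure R]_t ((t - c) * f t) +
  a2 * \int[@lebesgue_measure R]_t ((t - c) ^+ 2 * f t) +
  a3 * \int[@lebesgue_measure R]_t ((t - c) ^+ 3 * f t).
Proof.
move=> tf hE.
have cX n a : continuous (fun t : R => a * (t - c) ^+ n).
  by move=> t; apply: cvgM; [exact: cvg_cst|exact: continuous_shiftX].
have iX n a : (@lebesgue_measure R).-integrable setT
    (EFin \o (fun t => a * (t - c) ^+ n * f t)) by exact: tame_integrable.
have eX n a : a * \int[@lebesgue_measure R]_t ((t - c) ^+ n * f t) =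
    \int[@lebesgue_measure R]_t (a * (t - c) ^+ n * f t).
  rewrite -RintegralZl//; last by apply: tame_integrable => //; exact: continuous_shiftX.
  by apply: eq_Rintegral => t _; rewrite mulrA.
have -> : \int[@lebesgue_measure R]_t f t =
    \int[@lebesgue_measure R]_t ((t - c) ^+ 0 * f t).
  by apply: eq_Rintegral => t _; rewrite expr0 mul1r.
have -> : \int[@lebesgue_measure R]_t ((t - c) * f t) =
    \int[@lebesgue_measure R]_t ((t - c) ^+ 1 * f t).
  by apply: eq_Rintegral => t _; rewrite expr1.
have iD := @integrableD _ _ _ (@lebesgue_measure R) _ measurableT.
have i2 := iD _ _ (iX 0%N a0) (iX 1%N a1).
have i3 := iD _ _ i2 (iX 2%N a2).
rewrite !eX -!RintegralD//; try exact: iX.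
by apply: eq_Rintegral => t _; rewrite hE; ring.
Qed.

Lemma tame_Rintegral0_ae (R : realType) (h f : R -> R) :
  continuous h -> tame f -> (forall t, 0 <= h t * f t) ->
  \int[@lebesgue_measure R]_t (h t * f t) = 0 ->
  {ae @lebesgue_measure R, forall t, h t * f t = 0}.
Proof.
move=> ch tf hf0 /eqP; have ihf := tame_integrable ch tf.
rewrite /Rintegral fine_eq0 ?integrable_fin_num// => /eqP i0.
have /integrableP[mhf _] := ihf.
have := (ae_eq_integral_abs (@lebesgue_measure R) measurableT mhf).1.
case=> [|N [mN N0 NP]].
  by rewrite -[RHS]i0; apply: eq_integral => t _ /=; rewrite ger0_norm.
exists N; split => // t /= nt; apply: NP => /= H; apply: nt.
by have := H Logic.I => -[].
Qed.

(** * Truncated powers, reflection of integrals, and moments *)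

(** For [m = 0] this is the constant [c] on all of [a, b], the endpoint [a] included, because 0^0 =
    1. *)
Definition wedge {R : realType} (m : nat) (c a b t : R) : R :=
  if a <= t <= b then c * (t - a) ^+ m else 0.

Lemma tame_wedge (R : realType) (m : nat) (c a b : R) : tame (wedge m c a b).
Proof.
split.
  have -> : wedge m c a b = (fun t => c * (t - a) ^+ m) \_ `[a, b].
    by apply/funext => t; rewrite patchE mem_setE in_itv.
  apply/(measurable_restrictT _ _).1 => //.
  apply: measurable_funTS; apply: measurable_funM => //.
  apply: continuous_measurable_fun; exact: continuous_shiftX.
exists (`|a| + `|b| + `|c| * `|b - a| ^+ m) => t; rewrite /wedge.
have := normr_ge0 a; have := normr_ge0 b => b0 a0.
have c0 : 0 <= `|c| * `|b - a| ^+ m by rewrite mulr_ge0// exprn_ge0.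
case: ifPn => [/andP[ta tb]|]; last by rewrite normr0; split => //; lra.
have : `|c| * (t - a) ^+ m <= `|c| * `|b - a| ^+ m.
  rewrite ler_wpM2l// ger0_norm; last lra.
  by rewrite lerXn2r ?nnegrE; lra.
rewrite normrM (@ger0_norm _ ((t - a) ^+ m)); last by rewrite exprn_ge0//; lra.
move=> ?; split; first lra.
have := ler_norm b; have := ler_norm (- a); rewrite normrN => ? ?.
have : `|t| <= `|a| + `|b| by rewrite ler_norml; apply/andP; lra.
lra.
Qed.

(** Lebesgue measure is its own image under negation. *)
Lemma ge0_integral_reflect (R : realType) (f : R -> \bar R) :
  measurable_fun setT f -> (forall t, 0 <= f t)%E ->
  (\int[@lebesgue_measure R]_t f (- t)%R = \int[@lebesgue_measure R]_t f t)%E.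
Proof.
move=> mf f0.
have := @ge0_integral_pushforward _ _ _ _ R (-%R : measurableTypeR R -> measurableTypeR R)
  (@oppr_measurable R setT) (@lebesgue_measure R) setT f measurableT mf (fun t _ => f0 t).
rewrite preimage_setT => <-.
by apply: eq_measure_integral => //= A mA _; exact: lebesgue_measureN.
Qed.

Lemma integral_reflect (R : realType) (f : R -> \bar R) :
  measurable_fun setT f ->
  (\int[@lebesgue_measure R]_t f (- t)%R = \int[@lebesgue_measure R]_t f t)%E.
Proof.
move=> mf; rewrite [LHS]integralE [RHS]integralE.
have mp := measurable_funepos mf; have mn := measurable_funeneg mf.
rewrite -(ge0_integral_reflect mp)// -(ge0_integral_reflect mn)//.
congr (_ - _)%E; apply: eq_integral => t _.
  by rewrite !funeposE.
by rewrite !funenegE.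
Qed.

Lemma integral_shiftX (R : realType) (a b : R) (n : nat) : a < b ->
  (\int[@lebesgue_measure R]_(t in `[a, b]) ((t - a) ^+ n)%:E =
   ((b - a) ^+ n.+1 / n.+1%:R)%:E)%E.
Proof.
move=> ab.
have n0 : n.+1%:R != 0 :> R by rewrite pnatr_eq0.
have cF : continuous (fun t : R => (t - a) ^+ n.+1 / n.+1%:R).
  by move=> t; apply: cvgM; [exact: continuous_shiftX|exact: cvg_cst].
have dF (t : R) : is_derive t 1 (fun t => (t - a) ^+ n.+1 / n.+1%:R) ((t - a) ^+ n).
  have D : is_derive t 1 (fun s : R => s - a) 1.
    by rewrite -[X in is_derive _ _ _ X]subr0; exact: is_deriveB.
  have -> : (fun t : R => (t - a) ^+ n.+1 / n.+1%:R) =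
      n.+1%:R^-1 \*: ((fun s : R => s - a) ^+ n.+1).
    apply/funext => s; rewrite mulrC /= -[RHS]/(_ * _); congr (_ * _).
    by rewrite exprfctE.
  have := is_deriveZ n.+1%:R^-1 (is_deriveX n.+1 D).
  congr (is_derive _ _ _ _).
  by rewrite -[LHS]/(_ * (_ * _)); field.
rewrite (@continuous_FTC2 _ _ (fun t => (t - a) ^+ n.+1 / n.+1%:R))//.
- by rewrite -EFinB subrr expr0n/= mul0r subr0.
- exact/continuous_subspaceT/continuous_shiftX.
- split; first by move=> t _; have [] := dF t.
  + exact/cvg_at_right_filter/cF.
  + exact/cvg_at_left_filter/cF.
- by move=> t _; rewrite derive1E; have [] := dF t.
Qed.

(** Moments are taken about the apex [a], where the integrand is a pure power of [t - a]. *)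
Lemma wedge_moment (R : realType) (m j : nat) (c a b : R) : a < b ->
  \int[@lebesgue_measure R]_t ((t - a) ^+ j * wedge m c a b t) =
  c * (b - a) ^+ (m + j).+1 / (m + j).+1%:R.
Proof.
move=> ab.
have -> : \int[@lebesgue_measure R]_t ((t - a) ^+ j * wedge m c a b t) =
    \int[@lebesgue_measure R]_(t in `[a, b]) (c * (t - a) ^+ (m + j)).
  rewrite [RHS]Rintegral_mkcond; apply: eq_Rintegral => t _.
  rewrite patchE mem_setE in_itv/= /wedge; case: ifP => _; last by rewrite mulr0.
  by rewrite exprD; ring.
rewrite RintegralZl//.
  by rewrite /Rintegral integral_shiftX//= mulrA.
apply: continuous_compact_integrable; first exact: segment_compact.
exact/continuous_subspaceT/continuous_shiftX.
Qed.

(** One half of ]a, b[ avoids [c]. In use, [c] is a root of the comparison polynomial, where a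
    vanishing product says nothing about the other factor. *)
Lemma ae_itv_exists_neq (R : realType) (a b c : R) (P : R -> Prop) : a < b ->
  {ae @lebesgue_measure R, forall t, P t} ->
  exists t, [/\ a < t < b, t != c & P t].
Proof.
move=> ab aeP; have [cm|mc] := leP c ((a + b) / 2).
  have [|t /andP[t1 t2] Pt] := @ae_itv_exists _ ((a + b) / 2) b _ _ aeP; first lra.
  by exists t; split => //; [apply/andP; lra|lra].
have [|t /andP[t1 t2] Pt] := @ae_itv_exists _ a ((a + b) / 2) _ _ aeP; first lra.
by exists t; split => //; [apply/andP; lra|lra].
Qed.

Lemma wedge_ge0 (R : realType) (m : nat) (c a b t : R) : 0 <= c ->
  0 <= wedge m c a b t.
Proof.
rewrite /wedge => c0; case: ifPn => // /andP[ta _].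
by rewrite mulr_ge0// exprn_ge0// subr_ge0.
Qed.

Lemma wedge_out (R : realType) (m : nat) (c a b t : R) : ~~ (a <= t <= b) ->
  wedge m c a b t = 0.
Proof. by rewrite /wedge => /negbTE ->. Qed.

(** * Sign changes of the difference between [p] and a truncated power *)

(** Once [p] drops below the wedge, it stays at or below it up to [b]: a later excess at [y],
    together with the mass at [t0], would lift [p] to at least the wedge on the segment in between.
    So [t1] can be the infimum of the points where [p] is below. *)
Lemma sign_below_support (R : realType) (m : nat) (p : R -> R) (c a b t0 : R) :
  power_concave m p -> (forall t, 0 <= p t) -> 0 < c -> t0 < a -> 0 < p t0 ->
  exists t1, forall t, 0 <= (t - t1) * (t - b) * (p t - wedge m c a b t).
Proof.
move=> pc p0 c0 t0a pt0; set g := wedge m c a b.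
pose N := [set t | p t < g t].
have Nab t : N t -> a <= t <= b.
  rewrite /N/=; apply: contraPT => /wedge_out gt0.
  by rewrite /g gt0; apply/negP; rewrite -leNgt.
have Nup x y : N x -> x < y -> y <= b -> p y <= g y.
  move=> Nx xy yb; rewrite leNgt; apply/negP => gy.
  have /andP[ax xb] := Nab _ Nx.
  move: Nx; rewrite /N/=; apply/negP; rewrite -leNgt.
  have yab : a <= y <= b by apply/andP; lra.
  move: gy; rewrite /g /wedge yab ax xb/= => gy.
  pose l := (y - x) / (y - t0).
  have l0 : 0 < l by rewrite divr_gt0//; lra.
  have l1 : l < 1 by rewrite ltr_pdivrMr; lra.
  have xE : x = l * t0 + (1 - l) * y by rewrite /l; field; lra.
  (* The affine function equal to 0 at [t0] and [y - a] at [y] exceeds [x - a] at [x], because [t0]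
     lies left of the apex. *)
  have lE : (1 - l) * (y - a) = (x - a) + l * (a - t0) by rewrite xE; ring.
  have la : 0 < l * (a - t0) by rewrite mulr_gt0//; lra.
  apply: (@le_trans _ _ (c * (l * 0 + (1 - l) * (y - a)) ^+ m)).
    rewrite mulr0 add0r lE ler_wpM2l//; first exact: ltW.
    by rewrite lerXn2r ?nnegrE; lra.
  rewrite [X in _ <= p X]xE; apply: pc => //.
  - by apply: le_lt_trans gy; rewrite mulr_ge0 ?(ltW c0) ?exprn_ge0//; lra.
  - lra.
  - by apply/andP; lra.
  - by rewrite ltxx.
  - by move=> _; exact: ltW.
  - by rewrite mulr0 add0r lE; lra.
have out t : b < t -> 0 <= p t - g t.
  by move=> bt; rewrite /g wedge_out ?subr0//; apply/negP => /andP[]; lra.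
have [[x Nx]|N0] := pselect (N !=set0); last first.
  (* With [p] nowhere below the wedge, a double root at [b] makes the quadratic a square. *)
  exists b => t; rewrite -expr2 mulr_ge0 ?sqr_ge0// subr_ge0 leNgt.
  by apply/negP => Nt; apply: N0; exists t.
have lbN : has_lbound N by exists a => t /Nab/andP[].
exists (inf N) => t.
have [bt|tb] := ltP b t.
  have : inf N <= x by exact: ge_inf.
  have /andP[] := Nab _ Nx => *.
  by rewrite !mulr_ge0 ?out//; lra.
have [tN|Nt|tN] := ltgtP t (inf N).
- have : 0 <= p t - g t.
    rewrite subr_ge0 leNgt; apply/negP => Nt.
    by have := ge_inf lbN Nt; lra.
  by move=> ?; apply: mulr_ge0 => //; rewrite mulr_le0//; lra.
- have [|y Ny yt] := @inf_lt _ N t _ Nt; first by exists x.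
  have := Nup y t Ny yt tb => ?.
  by rewrite mulr_le0// ?mulr_ge0_le0//; lra.
- by rewrite tN subrr !mul0r.
Qed.

(** On [a, b] the wedge is itself of the form C f^m with f affine, so between two points where [p]
    exceeds it, [p] is at least the wedge. The infimum and supremum of these points are the first
    two sign changes; the last is at [b], where the wedge ends. *)
Lemma sign_in_support (R : realType) (m : nat) (p : R -> R) (c a b : R) :
  power_concave m p -> (forall t, 0 <= p t) -> 0 < c ->
  (forall t, 0 < p t -> a <= t) ->
  exists t1 t2, forall t,
    0 <= (t - t1) * (t - t2) * (t - b) * (p t - wedge m c a b t).
Proof.
move=> pc p0 c0 pa; set g := wedge m c a b.
(* Past [b] the wedge is 0 and [p] may exceed it again; the bound [t <= b] keeps that region out of
   [N]. *)
pose N := [set t | t <= b /\ g t < p t].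
have Nab t : N t -> a <= t.
  by move=> [_ gt]; apply: pa; apply: le_lt_trans gt; exact: wedge_ge0 (ltW _).
have Nmid x y z : N x -> N z -> x < y < z -> g y <= p y.
  move=> Nx Nz /andP[xy yz]; have ax := Nab _ Nx.
  have [xb gx] := Nx; have [zb gz] := Nz; move: gx gz.
  have xab : a <= x <= b by apply/andP; lra.
  have yab : a <= y <= b by apply/andP; lra.
  have zab : a <= z <= b by apply/andP; lra.
  rewrite /g /wedge xab yab zab => gx gz.
  pose l := (z - y) / (z - x).
  have l0 : 0 < l by rewrite divr_gt0//; lra.
  have l1 : l < 1 by rewrite ltr_pdivrMr; lra.
  have yE : y = l * x + (1 - l) * z by rewrite /l; field; lra.
  have lE : y - a = l * (x - a) + (1 - l) * (z - a) by rewrite {1}yE; ring.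
  rewrite lE [X in _ <= p X]yE; apply: pc => //.
  - by apply: le_lt_trans gx; rewrite mulr_ge0 ?(ltW c0) ?exprn_ge0//; lra.
  - by apply: le_lt_trans gz; rewrite mulr_ge0 ?(ltW c0) ?exprn_ge0//; lra.
  - lra.
  - lra.
  - by apply/andP; lra.
  - by move=> _; exact: ltW.
  - by move=> _; exact: ltW.
  - by rewrite -lE; lra.
have out t : b < t -> 0 <= p t - g t.
  by move=> bt; rewrite /g wedge_out ?subr0//; apply/negP => /andP[]; lra.
have [[x Nx]|N0] := pselect (N !=set0); last first.
  (* With [N] empty, the cubic (t - b)^3 has the single sign change that is left. *)
  exists b, b => t; rewrite -expr2 -mulrA mulr_ge0 ?sqr_ge0//.
  have [bt|tb] := ltP b t; first by rewrite mulr_ge0 ?out//; lra.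
  rewrite mulr_le0//; first lra.
  by rewrite subr_le0 leNgt; apply/negP => Nt; apply: N0; exists t.
have lbN : has_lbound N by exists a => t /Nab.
have ubN : has_ubound N by exists b => t [].
have ix : inf N <= x by exact: ge_inf.
have xs : x <= sup N by exact: ub_le_sup.
have sb : sup N <= b by apply: ge_sup; [exists x|move=> t []].
exists (inf N), (sup N) => t.
have [bt|tb] := ltP b t.
  by rewrite !mulr_ge0 ?out//; lra.
have notN : ~ N t -> p t - g t <= 0.
  by move=> nNt; rewrite subr_le0 leNgt; apply/negP => h; exact: nNt.
have [ti|it|ti] := ltgtP t (inf N).
- have h : p t - g t <= 0.
    by apply: notN => Nt; have := ge_inf lbN Nt; lra.
  apply: mulr_le0 => //; apply: mulr_ge0_le0; last lra.
  by apply: mulr_le0; lra.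
- have [ts|st|st] := ltgtP t (sup N).
  + have [|y Ny yt] := @inf_lt _ N t _ it; first by exists x.
    have [|z Nz tz] := @sup_gt _ N t _ ts; first by exists x.
    have h : g t <= p t by apply: (Nmid y t z) => //; apply/andP.
    apply: mulr_ge0; last lra.
    by apply: mulr_le0; [apply: mulr_ge0_le0; lra|lra].
  + have h : p t - g t <= 0.
      by apply: notN => Nt; have := ub_le_sup ubN Nt; lra.
    apply: mulr_le0 => //; apply: mulr_ge0_le0; last lra.
    by apply: mulr_ge0; lra.
  + by rewrite st subrr mulr0 !mul0r.
- by rewrite ti subrr !mul0r.
Qed.

(** * Reflection and low moments of densities *)

Lemma prob_density_reflect (R : realType) (p : R -> R) :
  prob_density p -> prob_density (fun t => p (- t)).
Proof.
move=> [mp p0 p1]; split => //; first exact: measurableT_comp.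
by rewrite (@integral_reflect R (EFin \o p))//; exact/measurable_EFinP.
Qed.

Lemma mu1_reflect (R : realType) (p : R -> R) : tame p ->
  mu1 (fun t => p (- t)) = - mu1 p.
Proof.
move=> tp; have ti := @tame_integrable _ (fun t => - t) _ (@oppr_continuous _ _) tp.
have -> : - mu1 p = \int[@lebesgue_measure R]_t (- t * p t).
  rewrite /mu1 -mulN1r -RintegralZl//; last exact: (tame_integrable (fun t => @cvg_id _ _) tp).
  by apply: eq_Rintegral => t _; rewrite mulN1r mulNr.
have /integrableP[mf _] := ti.
rewrite /mu1 /Rintegral -(integral_reflect mf); congr fine.
by apply: eq_integral => t _ /=; rewrite opprK.
Qed.

Lemma central_moment_reflect (R : realType) (n : nat) (p : R -> R) : tame p ->
  central_moment n (fun t => p (- t)) = (-1) ^+ n * central_moment n p.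
Proof.
move=> tp; rewrite /central_moment mu1_reflect//.
have cX : continuous (fun t : R => (-1) ^+ n * (t - mu1 p) ^+ n).
  by move=> t; apply: cvgM; [exact: cvg_cst|exact: continuous_shiftX].
rewrite -RintegralZl//; last exact/tame_integrable/tp/continuous_shiftX.
have /integrableP[mf _] := tame_integrable cX tp.
have -> : \int[@lebesgue_measure R]_t ((-1) ^+ n * ((t - mu1 p) ^+ n * p t)) =
    \int[@lebesgue_measure R]_t ((-1) ^+ n * (t - mu1 p) ^+ n * p t).
  by apply: eq_Rintegral => t _; rewrite mulrA.
rewrite /Rintegral -(integral_reflect mf); congr fine.
apply: eq_integral => t _ /=; congr (_ * _)%:E.
by rewrite -exprMn; congr (_ ^+ _); ring.
Qed.

Lemma prob_density_moments (R : realType) (p : R -> R) :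
  prob_density p -> tame p ->
  \int[@lebesgue_measure R]_t p t = 1 /\
  \int[@lebesgue_measure R]_t ((t - mu1 p) * p t) = 0.
Proof.
move=> [_ _ p1] tp.
have i1 : \int[@lebesgue_measure R]_t p t = 1 by rewrite /Rintegral p1.
split=> //.
have hE t : t - mu1 p = - mu1 p + 1 * (t - 0) + 0 * (t - 0) ^+ 2 + 0 * (t - 0) ^+ 3.
  by ring.
rewrite (tame_Rintegral_cubic tp hE) i1.
rewrite [X in _ + 1 * X + _ + _](_ : _ = mu1 p); last first.
  by apply: eq_Rintegral => t _; rewrite subr0.
ring.
Qed.

(** Zero variance would make [p] vanish almost everywhere, the mean being only one more null
    point. *)
Lemma central_moment2_gt0 (R : realType) (p : R -> R) :
  prob_density p -> tame p -> 0 < central_moment 2 p.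
Proof.
move=> dp tp; have [_ p0 _] := dp; rewrite lt_def; apply/andP; split; last first.
  by apply: Rintegral_ge0 => t _; rewrite mulr_ge0// sqr_ge0.
apply/eqP => /(tame_Rintegral0_ae (@continuous_shiftX _ _ 2) tp) h.
apply: (prob_density_not_ae0 dp).
have [N [mN N0 NP]] := h (fun t => mulr_ge0 (sqr_ge0 _) (p0 t)).
exists (N `|` [set mu1 p]); split.
- exact: measurableU.
- by rewrite measureU0 ?N0//; exact: lebesgue_measure_set1.
move=> t /= pt; have [->|tm] := eqVneq t (mu1 p); [by right|left].
apply: NP => /= /eqP; rewrite mulf_eq0 expf_eq0/= subr_eq0 (negbTE tm)/=.
by move/eqP.
Qed.

(** * The cone density *)

(* [d] is the distance from the apex to the mean, and [L] the length of the
   support. *)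
Definition cone_density {R : realType} (k : nat) (mu d : R) : R -> R :=
  let L := k.+1%:R / k%:R * d in
  wedge k.-1 (k%:R / L ^+ k) (mu - d) (mu - d + L).

(** The j-th moment about the apex is K L^j / (K + j). The first one equals [d], which puts the mean
    at [mu]; expanding powers of [t - mu] about the apex gives the others. *)
Lemma cone_density_moments (R : realType) (k : nat) (mu d : R) :
  (0 < k)%N -> 0 < d -> let g := cone_density k mu d in
  [/\ \int[@lebesgue_measure R]_t g t = 1,
      \int[@lebesgue_measure R]_t ((t - mu) * g t) = 0,
      \int[@lebesgue_measure R]_t ((t - mu) ^+ 2 * g t) =
        d ^+ 2 / (k%:R * (k%:R + 2)) &
      \int[@lebesgue_measure R]_t ((t - mu) ^+ 3 * g t) =
        - (2 * (k%:R - 1) * d ^+ 3 / (k%:R ^+ 2 * (k%:R + 2) * (k%:R + 3)))].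
Proof.
case: k => // m _ d0 g; pose K : R := m.+1%:R; pose L := (K + 1) / K * d.
have K0 : 0 < K by rewrite ltr0n.
have m0 := ler0n R m.
have L0 : 0 < L by rewrite mulr_gt0 ?divr_gt0//; lra.
have gE : g = wedge m (K / L ^+ m.+1) (mu - d) (mu - d + L).
  by rewrite /g /cone_density /L -[m.+2%:R]natr1.
have tg : tame g by rewrite gE; exact: tame_wedge.
have M j : \int[@lebesgue_measure R]_t ((t - (mu - d)) ^+ j * g t) =
    K * L ^+ j / (K + j%:R).
  rewrite gE wedge_moment; last by rewrite ltrDl.
  rewrite (addrC (mu - d)) addrK -addSn exprD natrD -/K.
  have j0 := ler0n R j; field.
  by rewrite (gt_eqF (exprn_gt0 _ L0)) andbT; lra.
have M0 : \int[@lebesgue_measure R]_t g t = 1.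
  transitivity (\int[@lebesgue_measure R]_t ((t - (mu - d)) ^+ 0 * g t)).
    by apply: eq_Rintegral => t _; rewrite expr0 mul1r.
  by rewrite M; field; lra.
have M1 : \int[@lebesgue_measure R]_t ((t - (mu - d)) * g t) = K * L / (K + 1).
  by rewrite -[in RHS](expr1 L) -(M 1%N).
have cub := @tame_Rintegral_cubic R g _ (mu - d) _ _ _ _ tg.
split=> //.
- rewrite (cub _ (- d) 1 0 0)//; last by move=> t; ring.
  by rewrite M0 M1 !M /L; field; lra.
- rewrite (cub _ (d ^+ 2) (- 2 * d) 1 0)//; last by move=> t; ring.
  by rewrite M0 M1 !M /L -/K; field; lra.
- rewrite (cub _ (- d ^+ 3) (3 * d ^+ 2) (- 3 * d) 1)//; last by move=> t; ring.
  by rewrite M0 M1 !M /L -/K; field; lra.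
Qed.

(** * Comparison of [p] with the cone density of equal mean and variance *)

Section Comparison.
Variables (R : realType) (k : nat) (p : R -> R) (d : R).
Hypotheses (k0 : (0 < k)%N) (dp : prob_density p) (pc : power_concave k.-1 p).
Hypotheses (d0 : 0 < d) (dE : d ^+ 2 = k%:R * (k%:R + 2) * central_moment 2 p).

Let g := cone_density k (mu1 p) d.
Let tp : tame p := power_concave_density_tame dp pc.
Let tg : tame g := tame_wedge _ _ _ _.
Let K0 : (0 : R) < k%:R. Proof. by rewrite ltr0n. Qed.

(** Mass, mean and, by [dE], variance agree, so only the cubic coefficient survives, times the
    difference of the third central moments. *)
Lemma cone_density_diff_moment (h : R -> R) (a0 a1 a2 a3 : R) : continuous h ->
  (forall t, h t = a0 + a1 * (t - mu1 p) + a2 * (t - mu1 p) ^+ 2 +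
                   a3 * (t - mu1 p) ^+ 3) ->
  \int[@lebesgue_measure R]_t (h t * (p t - g t)) =
  a3 * (mu3_3 p +
        2 * (k%:R - 1) * d ^+ 3 / (k%:R ^+ 2 * (k%:R + 2) * (k%:R + 3))).
Proof.
move=> ch hE; have [i0 i1] := prob_density_moments dp tp.
have [g0 g1 g2 g3] := cone_density_moments (mu1 p) k0 d0.
rewrite tame_Rintegral_sub// (tame_Rintegral_cubic tp hE).
rewrite (tame_Rintegral_cubic tg hE) i0 i1 g0 g1 g2 g3 dE.
rewrite -/(central_moment 2 p) -/(central_moment 3 p) -/(mu3_3 p).
by field; rewrite !gt_eqF ?addr_gt0.
Qed.

Lemma power_concave_support_ge (t : R) : 0 < p t -> mu1 p - d <= t.
Proof.
move=> pt; rewrite leNgt; apply/negP => ta; have [_ p0 _] := dp.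
have L0 : 0 < k.+1%:R / k%:R * d by rewrite mulr_gt0// divr_gt0.
have c0 : 0 < k%:R / (k.+1%:R / k%:R * d) ^+ k by rewrite divr_gt0// exprn_gt0.
set a := mu1 p - d in ta *; pose b := a + k.+1%:R / k%:R * d.
have ab : a < b by rewrite ltrDl.
have [t1 sgn] := sign_below_support b pc p0 c0 ta pt.
have ch : continuous (fun t => (t - t1) * (t - b)).
  by move=> s; apply: cvgM; exact: (@continuous_shiftX R _ 1).
have := tame_Rintegral0_ae ch (tame_sub tp tg) sgn.
(* A quadratic has cubic coefficient 0, so its integral against [p - g] is 0 and the product
   vanishes almost everywhere. *)
rewrite (@cone_density_diff_moment _ ((mu1 p - t1) * (mu1 p - b))
  (2 * mu1 p - t1 - b) 1 0)//; last by move=> s; ring.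
rewrite mul0r => /(_ erefl) H.
(* The contradiction comes from two points: [s] inside the cone, where p = g > 0, and [r] between
   [t] and the apex, where p = g = 0 although [r] lies between the support points [t] and [s]. *)
have [s [/andP[sa sb] st hs]] := ae_itv_exists_neq t1 ab H.
have [r [/andP[rt ra] r1 hr]] := ae_itv_exists_neq t1 ta H.
have ps : 0 < p s.
  move/eqP: hs; rewrite !mulf_eq0 !subr_eq0 (negbTE st) lt_eqF//= => /eqP ->.
  rewrite /g /cone_density /wedge ifT; last by apply/andP; split; exact: ltW.
  by rewrite mulr_gt0// exprn_gt0// subr_gt0.
have : 0 < p r.
  apply: (power_concave_gt0 pc pt ps); apply/andP; split; first exact: ltW.
  by apply/ltW; exact: lt_trans sa.
move/eqP: hr; rewrite !mulf_eq0 !subr_eq0 (negbTE r1) lt_eqF/=; last first.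
  exact: lt_trans ab.
move=> /eqP ->; rewrite /g /cone_density wedge_out ?ltxx//.
by apply/negP => /andP[+ _]; rewrite leNgt ra.
Qed.

Lemma mu3_3_ge :
  - (2 * (k%:R - 1) * d ^+ 3 / (k%:R ^+ 2 * (k%:R + 2) * (k%:R + 3))) <= mu3_3 p.
Proof.
have [_ p0 _] := dp.
have L0 : 0 < k.+1%:R / k%:R * d by rewrite mulr_gt0// divr_gt0.
have c0 : 0 < k%:R / (k.+1%:R / k%:R * d) ^+ k by rewrite divr_gt0// exprn_gt0.
pose a := mu1 p - d; pose b := a + k.+1%:R / k%:R * d.
have [t1 [t2 sgn]] := sign_in_support b pc p0 c0 power_concave_support_ge.
have ch : continuous (fun t => (t - t1) * (t - t2) * (t - b)).
  move=> s; apply: cvgM; first apply: cvgM; exact: (@continuous_shiftX R _ 1).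
have : 0 <= \int[@lebesgue_measure R]_t ((t - t1) * (t - t2) * (t - b) * (p t - g t)).
  by apply: Rintegral_ge0 => t _; exact: sgn.
(* Each factor is [t - mu1 p] plus some [u], so the coefficients about the mean are the elementary
   symmetric functions of the [u]. *)
pose u1 := mu1 p - t1; pose u2 := mu1 p - t2; pose u3 := mu1 p - b.
rewrite (@cone_density_diff_moment _ (u1 * u2 * u3)
  (u1 * u2 + u1 * u3 + u2 * u3) (u1 + u2 + u3) 1)//; last first.
  by move=> s; rewrite /u1 /u2 /u3; ring.
by rewrite mul1r -lerBlDr sub0r.
Qed.

End Comparison.

Theorem proposition1 (R : realType) (k : nat) (hk : (1 <= k)%N) (p : R -> R)
    (hp : prob_density p) (hc : s_concave (concavity_exponent k) p) :
  `|mu3_3 p| <=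
     2 * Num.sqrt ((k%:R + 2) / k%:R) * ((k%:R - 1) / (k%:R + 3)) * mu2 p ^+ 3
  /\ (Supp p 0 -> mu1 p ^+ 2 <= k%:R * (k%:R + 2) * mu2 p ^+ 2).
Proof.
have pc : power_concave k.-1 p by case: k hk hc => // m _; exact: s_concave_power_concave.
have K0 : (0 : R) < k%:R by rewrite ltr0n.
have tp := power_concave_density_tame hp pc.
have v0 := central_moment2_gt0 hp tp.
pose s := Num.sqrt ((k%:R + 2) / k%:R : R).
have s2 : s ^+ 2 = (k%:R + 2) / k%:R by rewrite sqr_sqrtr// divr_ge0; lra.
have s0 : 0 < s by rewrite sqrtr_gt0 divr_gt0; lra.
have m2 : mu2 p ^+ 2 = central_moment 2 p by rewrite sqr_sqrtr// ltW.
have m0 : 0 < mu2 p by rewrite sqrtr_gt0.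
(* This is sqrt (k (k + 2)) times [mu2 p], written through [s] so that s^3 = s (k + 2) / k turns the
   cone's third moment into the stated bound. *)
pose d := k%:R * s * mu2 p.
have d0 : 0 < d by rewrite !mulr_gt0.
have dE : d ^+ 2 = k%:R * (k%:R + 2) * central_moment 2 p.
  by rewrite -m2 !exprMn s2; field; lra.
have rp := prob_density_reflect hp; have rc := power_concave_reflect pc.
have rE : d ^+ 2 = k%:R * (k%:R + 2) * central_moment 2 (fun t => p (- t)).
  by rewrite central_moment_reflect// sqrrN expr1n mul1r.
split.
  have -> : 2 * s * ((k%:R - 1) / (k%:R + 3)) * mu2 p ^+ 3 =
      2 * (k%:R - 1) * d ^+ 3 / (k%:R ^+ 2 * (k%:R + 2) * (k%:R + 3)).
    by rewrite /d !exprMn [s ^+ 3]exprS s2; field; lra.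
  rewrite ler_norml; apply/andP; split; first exact: mu3_3_ge.
  (* Reflection negates the third central moment, so the lower bound for the reflected density is
     the upper bound for [p]. *)
  have := mu3_3_ge hk rp rc d0 rE.
  by rewrite /mu3_3 central_moment_reflect// -signr_odd /= expr1 mulN1r lerN2.
rewrite m2 -dE => S0.
(* As 0 is only in the closure of the positivity set, the bounds on support points reach it through
   closed half-lines. *)
have le0 (C : set R) : closed C -> (forall t, 0 < p t -> C t) -> C 0.
  by move=> cC pC; rewrite ((closure_id C).1 cC); exact: closureS S0.
have : mu1 p - d <= 0.
  apply: (le0 [set t | mu1 p - d <= t]) => [|t]; first exact: closed_ge.
  exact: (power_concave_support_ge hk hp pc d0 dE).
have : 0 <= mu1 p + d.
  apply: (le0 [set t | t <= mu1 p + d]); first exact: closed_le.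
  move=> t pt /=; have := power_concave_support_ge hk rp rc d0 rE (t := - t).
  by rewrite opprK mu1_reflect// => /(_ pt); lra.
(* The two bounds say that (d - mu1)(d + mu1) is a product of nonnegative factors. *)
nra.
Qed.
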